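(* For every torus $T$ over $\Bbbk$ there is an affine variety $X$ over $\Bbbk$ such that $\operatorname{Aut}(X)\simeq T$ as ind-groups.
   Context: The base field $\Bbbk$ is algebraically closed of characteristic zero; varieties are reduced algebraic varieties over $\Bbbk$, not necessarily irreducible or connected. A torus is an algebraic group isomorphic to $(\Bbbk^* )^m$ for some $m$. An ind-variety is a set $\mathcal V$ with an ascending filtration $\mathcal V_0\subseteq\mathcal V_1\subseteq\cdots$, $\mathcal V=\bigcup_k\mathcal V_k$, such that each $\mathcal V_k$ is an algebraic variety and $\mathcal V_k$ is Zariski-closed in $\mathcal V_{k+1}$. A morphism $\phi:\mathcal V\to\mathcal W$ of ind-varieties is a map such that for every $k$ there is an $m$ with $\phi(\mathcal V_k)\subseteq\mathcal W_m$ and $\mathcal V_k\to\mathcal W_m$ a morphism of varieties. An ind-group is an ind-variety with a group structure such that multiplication and inversion are morphisms; an algebraic group is an ind-group via the constant filtration. For an affine variety $X$ the group $\operatorname{Aut}(X)$ is an ind-group as follows: for a closed embedding $X\subseteq\mathbb A^m$, $\operatorname{End}(X)$ is identified with a closed subset of $\mathcal O(X)^m$, where $\mathcal O(X)$ is filtered by finite-dimensional subspaces, and $\operatorname{Aut}(X)$ is identified with the closed subset $\{(\alpha,\beta)\mid\alpha\circ\beta=\beta\circ\alpha=\operatorname{id}\}\subseteq\operatorname{End}(X)\times\operatorname{End}(X)$. *)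

(* Defs.v *)
From HB Require Import structures.
From mathcomp Require Import all_boot all_order all_algebra.
From mathcomp Require Import boolp classical_sets.
From mathcomp Require Import mpoly.

Set Implicit Arguments.
Unset Strict Implicit.
Unset Printing Implicit Defensive.

Import Order.TTheory GRing.Theory.

Local Open Scope classical_set_scope.
Local Open Scope ring_scope.

(* Points of the affine space A^n are row vectors, and a polynomial p takes
   the value p.@[z 0] at z : 'rV[K]_n. *)
Definition zclosed (K : closedFieldType) n (Z : set 'rV[K]_n) : Prop :=
  exists S : set {mpoly K[n]}, Z = [set z | forall p, S p -> p.@[z 0] = 0].

(* An algebraic variety whose points form a subset of T is given by finitely
   many charts; chart i identifies dom i with a closed subset of an affine
   space. The values of chart i outside dom i are irrelevant. *)
Record atlas (K : closedFieldType) (T : Type) := Atlas {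
  idx : finType;
  dim : idx -> nat;
  dom : idx -> set T;
  chart : forall i, T -> 'rV[K]_(dim i) }.
Arguments dom {K T} V i _ : rename.

Definition pts (K : closedFieldType) T (V : atlas K T) : set T :=
  [set x | exists i, dom V i x].

(* f restricted to the subset A of the variety V is a morphism to W: around
   each point it is given, in charts, by fractions p / h with h non-zero. *)
Definition regular_on (K : closedFieldType) T S (A : set T)
    (V : atlas K T) (W : atlas K S) (f : T -> S) : Prop :=
  forall x, A x -> pts W (f x) /\
  forall i j, dom V i x -> dom W j (f x) ->
  exists (h : {mpoly K[dim i]}) (p : 'I_(dim j) -> {mpoly K[dim i]}),
    h.@[chart i x 0] != 0 /\
    forall y, A y -> dom V i y -> h.@[chart i y 0] != 0 ->
      dom W j (f y) /\
      forall l, chart j (f y) 0 l = (p l).@[chart i y 0] / h.@[chart i y 0].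

Definition morphism (K : closedFieldType) T S (V : atlas K T) (W : atlas K S)
  (f : T -> S) : Prop := regular_on (pts V) V W f.

Definition vclosed (K : closedFieldType) T (V : atlas K T) (A : set T) : Prop :=
  forall i, zclosed [set @chart K T V i x | x in A `&` dom V i].

(* The third clause says that the charts are compatible, i.e. that overlaps are
   open and the changes of charts are regular; the last one is separatedness:
   the diagonal is closed in the product of any two charts. *)
Definition is_variety (K : closedFieldType) T (V : atlas K T) : Prop :=
  [/\ forall i x y, dom V i x -> dom V i y -> chart i x = chart i y -> x = y,
      forall i, zclosed [set @chart K T V i x | x in dom V i],
      morphism V V id &
      forall i j, zclosed
        [set row_mx (@chart K T V i x) (@chart K T V j x)
          | x in dom V i `&` dom V j]].

(* The last two clauses say that the structure of V is the one induced by W. *)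
Definition closed_subvariety (K : closedFieldType) T (V W : atlas K T) : Prop :=
  [/\ pts V `<=` pts W, vclosed W (pts V),
      regular_on (pts V) V W id & regular_on (pts V) W V id].

Definition prod_atlas (K : closedFieldType) T S (V : atlas K T) (W : atlas K S)
    : atlas K (T * S) :=
  @Atlas K (T * S) (idx V * idx W)%type
    (fun ij => dim ij.1 + dim ij.2)%N
    (fun ij => [set xy | dom V ij.1 xy.1 /\ dom W ij.2 xy.2])
    (fun ij xy => row_mx (chart ij.1 xy.1) (chart ij.2 xy.2)).

(* The structure on S for which the injection j : S -> T is an isomorphism onto
   a (closed) subvariety of V. *)
Definition pull_atlas (K : closedFieldType) S T (j : S -> T) (V : atlas K T)
    : atlas K S :=
  @Atlas K S (idx V) (@dim K T V) (fun i => j @^-1` dom V i)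
    (fun i x => chart i (j x)).

Definition affine_atlas (K : closedFieldType) T n (D : set T)
    (c : T -> 'rV[K]_n) : atlas K T :=
  @Atlas K T unit (fun=> n) (fun=> D) (fun=> c).

Definition is_ind_variety (K : closedFieldType) T (V : nat -> atlas K T)
    : Prop :=
  [/\ forall k, is_variety (V k),
      forall k, closed_subvariety (V k) (V k.+1) &
      forall x, exists k, pts (V k) x].

Definition ind_morphism (K : closedFieldType) T S (V : nat -> atlas K T)
    (W : nat -> atlas K S) (f : T -> S) : Prop :=
  forall k, exists m, morphism (V k) (W m) f.

Record indGroup (K : closedFieldType) := IndGroup {
  ig_group :> groupType;
  ig_filt : nat -> atlas K ig_group;
  ig_ind_variety : is_ind_variety ig_filt;
  ig_mul : ind_morphism (fun k => prod_atlas (ig_filt k) (ig_filt k)) ig_filt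
             (fun xy => (xy.1 * xy.2)%g);
  ig_inv : ind_morphism ig_filt ig_filt (fun x => x^-1%g) }.

Definition ind_group_iso (K : closedFieldType) (G H : indGroup K) : Prop :=
  exists (f : G -> H) (g : H -> G),
    [/\ cancel f g, cancel g f, {morph f : x y / (x * y)%g},
        ind_morphism (ig_filt G) (ig_filt H) f &
        ind_morphism (ig_filt H) (ig_filt G) g].

Record algGroup (K : closedFieldType) := AlgGroup {
  ag_group :> groupType;
  ag_atlas : atlas K ag_group;
  ag_variety : is_variety ag_atlas;
  ag_full : forall x, pts ag_atlas x;
  ag_mul : morphism (prod_atlas ag_atlas ag_atlas) ag_atlas
             (fun xy => (xy.1 * xy.2)%g);
  ag_inv : morphism ag_atlas ag_atlas (fun x => x^-1%g) }.

Definition alg_group_iso (K : closedFieldType) (G H : algGroup K) : Prop :=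
  exists (f : G -> H) (g : H -> G),
    [/\ cancel f g, cancel g f, {morph f : x y / (x * y)%g},
        morphism (ag_atlas G) (ag_atlas H) f &
        morphism (ag_atlas H) (ag_atlas G) g].

Section Zariski.
Variable K : closedFieldType.
Implicit Types n : nat.

Lemma zclosedP n I (F : I -> {mpoly K[n]}) (Z : set 'rV[K]_n) :
  (forall z, Z z <-> forall i, (F i).@[z 0] = 0) -> zclosed Z.
Proof.
move=> ZP; exists (range F); apply/seteqP; split => z /=.
  by move=> /ZP Zz p [i _ <-].
by move=> Zz; apply/ZP => i; apply: Zz; exists i.
Qed.

Lemma zclosedE n (Z : set 'rV[K]_n) : zclosed Z ->
  exists S : set {mpoly K[n]}, forall z, Z z <-> forall p, S p -> p.@[z 0] = 0.
Proof. by case=> S ->; exists S. Qed.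

Definition polyfun n (g : 'rV[K]_n -> K) : Prop :=
  exists p : {mpoly K[n]}, forall z, g z = p.@[z 0].

Lemma polyfun_ext n (f g : 'rV[K]_n -> K) :
  f =1 g -> polyfun f -> polyfun g.
Proof. by move=> fg [p pE]; exists p => z; rewrite -fg. Qed.

Lemma polyfun_const n c : polyfun (fun _ : 'rV[K]_n => c).
Proof. by exists c%:MP_[n] => z; rewrite mevalC. Qed.

Lemma polyfun_coord n i : polyfun (fun z : 'rV[K]_n => z 0 i).
Proof. by exists 'X_i => z; rewrite mevalXU. Qed.

Lemma polyfunB n (f g : 'rV[K]_n -> K) :
  polyfun f -> polyfun g -> polyfun (fun z => f z - g z).
Proof. by move=> [p pE] [q qE]; exists (p - q) => z; rewrite mevalB pE qE. Qed.

Lemma polyfunD n (f g : 'rV[K]_n -> K) :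
  polyfun f -> polyfun g -> polyfun (fun z => f z + g z).
Proof. by move=> [p pE] [q qE]; exists (p + q) => z; rewrite mevalD pE qE. Qed.

Lemma polyfunM n (f g : 'rV[K]_n -> K) :
  polyfun f -> polyfun g -> polyfun (fun z => f z * g z).
Proof. by move=> [p pE] [q qE]; exists (p * q) => z; rewrite mevalM pE qE. Qed.

Lemma polyfunX n (f : 'rV[K]_n -> K) k :
  polyfun f -> polyfun (fun z => f z ^+ k).
Proof.
move=> pf; elim: k => [|k IH]; first exact: polyfun_const.
by apply: polyfun_ext (polyfunM pf IH) => z; rewrite exprS.
Qed.

Lemma polyfun_sum n I (r : seq I) (F : I -> 'rV[K]_n -> K) :
  (forall i, polyfun (F i)) -> polyfun (fun z => \sum_(i <- r) F i z).
Proof.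
move=> pF; elim: r => [|i r IH].
  by apply: polyfun_ext (polyfun_const n 0) => z; rewrite big_nil.
by apply: polyfun_ext (polyfunD (pF i) IH) => z; rewrite big_cons.
Qed.

Lemma polyfun_prod n I (r : seq I) (F : I -> 'rV[K]_n -> K) :
  (forall i, polyfun (F i)) -> polyfun (fun z => \prod_(i <- r) F i z).
Proof.
move=> pF; elim: r => [|i r IH].
  by apply: polyfun_ext (polyfun_const n 1) => z; rewrite big_nil.
by apply: polyfun_ext (polyfunM (pF i) IH) => z; rewrite big_cons.
Qed.

Lemma polyfun_meval n k (p : {mpoly K[k]}) (e : 'I_k -> 'rV[K]_n -> K) :
  (forall i, polyfun (e i)) -> polyfun (fun z => p.@[e ^~ z]).
Proof.
move=> pe; apply: (@polyfun_ext _
  (fun z => \sum_(m <- msupp p) p@_m * \prod_i e i z ^+ m i)) => [z|].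
  by rewrite mevalE.
apply: polyfun_sum => m; apply: polyfunM; first exact: polyfun_const.
by apply: polyfun_prod => i; apply: polyfunX.
Qed.

Lemma zclosed_forall n I (Z : I -> set 'rV[K]_n) :
  (forall i, zclosed (Z i)) -> zclosed [set z | forall i, Z i z].
Proof.
move=> cZ; have /choice[S SP] := fun i => zclosedE (cZ i).
apply: (@zclosedP _ {ip : I * {mpoly K[n]} | S ip.1 ip.2}
  (fun ip => (sval ip).2)) => z; split=> [Zz [[i p] Sp] /=|H i].
  exact: (SP i z).1 (Zz i) p Sp.
by apply/SP => p Sp; apply: (H (exist _ (i, p) Sp)).
Qed.

Lemma zclosed_and n (Y Z : set 'rV[K]_n) :
  zclosed Y -> zclosed Z -> zclosed [set z | Y z /\ Z z].
Proof.
move=> cY cZ; have := @zclosed_forall n bool (fun b => if b then Y else Z).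
rewrite (_ : [set z | forall i : bool, _] = [set z | Y z /\ Z z]); last first.
  apply/seteqP; split=> z /= H; first by split; [apply: (H true)|apply: (H false)].
  by case; case: H.
by apply; case.
Qed.

Lemma zclosed_polyfun n I (F : I -> 'rV[K]_n -> K) (Z : set 'rV[K]_n) :
  (forall i, polyfun (F i)) -> (forall z, Z z <-> forall i, F i z = 0) ->
  zclosed Z.
Proof.
move=> /choice[p pE] ZP; apply: (zclosedP (F := p)) => z.
by rewrite ZP; split => H i; move: (H i); rewrite pE.
Qed.

Lemma zclosed_eq n (f g : 'rV[K]_n -> K) :
  polyfun f -> polyfun g -> zclosed [set z | f z = g z].
Proof.
move=> pf pg; apply: (@zclosed_polyfun _ unit (fun=> fun z => f z - g z)).
  by move=> _; apply: polyfunB.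
move=> z /=; split=> [-> _|/(_ tt)/eqP]; first by rewrite subrr.
by rewrite subr_eq0 => /eqP.
Qed.

End Zariski.
Arguments polyfun_const {K n} c.
Arguments polyfun_coord {K n} i.

Section OneChart.
Variable K : closedFieldType.

Lemma regular_on_poly T S (A : set T) (V : atlas K T) (W : atlas K S)
    (f : T -> S) (j0 : idx W) : (forall j, j = j0) ->
  (forall x, A x -> dom W j0 (f x)) ->
  (forall i l, exists2 g, polyfun g &
     forall x, A x -> dom V i x -> chart j0 (f x) 0 l = g (@chart K T V i x)) ->
  regular_on A V W f.
Proof.
move=> j0E fA fP x Ax; split; first by exists j0; apply: fA.
move=> i j _ _; rewrite (j0E j) {j}.
have /choice[p pE] : forall l, exists p : {mpoly K[dim i]}, forall x, A x ->
    dom V i x -> chart j0 (f x) 0 l = p.@[chart i x 0].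
  move=> l; have [g [p pE] gE] := fP i l; exists p => y Ay iy.
  by rewrite gE // pE.
exists 1, p; split; first by rewrite meval1 oner_neq0.
move=> y Ay iy _; split; first exact: fA.
by move=> l; rewrite meval1 divr1 pE.
Qed.

Lemma one_chart_variety T (V : atlas K T) (i0 : idx V) :
  (forall i, i = i0) ->
  (forall x y, dom V i0 x -> dom V i0 y -> chart i0 x = chart i0 y -> x = y) ->
  zclosed [set @chart K T V i0 x | x in dom V i0] ->
  is_variety V.
Proof.
move=> i0E inj cl; split.
- by move=> i; rewrite (i0E i).
- by move=> i; rewrite (i0E i).
- apply: (@regular_on_poly _ _ _ _ _ _ i0) => //.
    by move=> x [i]; rewrite (i0E i).
  move=> i l; rewrite (i0E i).
  by exists (fun z => z 0 l); [apply: polyfun_coord | ].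
- move=> i j; rewrite (i0E i) (i0E j).
  have [S SP] := zclosedE cl.
  pose F (a : 'I_(@dim K T V i0) + {p | S p}) (z : 'rV_(dim i0 + dim i0)) :=
    match a with
    | inl l => z 0 (lshift _ l) - z 0 (rshift _ l)
    | inr p => (sval p).@[fun l => z 0 (lshift _ l)]
    end.
  apply: (zclosed_polyfun (F := F)) => [[l|p]|z] /=.
  + by apply: polyfunB; apply: polyfun_coord.
  + by apply: polyfun_meval => l; apply: polyfun_coord.
  + have ev p : p.@[lsubmx z 0] = p.@[fun l => z 0 (lshift _ l)].
      by apply: meval_eq => l; rewrite mxE.
    split=> [[x [/= dx _] <-] [l|[p Sp]] /=|H].
    * by rewrite row_mxEl row_mxEr subrr.
    * have /SP/(_ p Sp) <- : [set @chart K T V i0 x | x in dom V i0] (chart i0 x).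
        by exists x.
      by apply: meval_eq => l; rewrite row_mxEl.
    * have /SP [x dx xE] : forall p, S p -> p.@[lsubmx z 0] = 0.
        by move=> p Sp; rewrite ev; apply: (H (inr (exist _ p Sp))).
      exists x => //; rewrite xE -[RHS]hsubmxK; congr row_mx.
      apply/rowP => l; rewrite !mxE; apply/eqP; rewrite -subr_eq0.
      by apply/eqP; apply: (H (inl l)).
Qed.

End OneChart.

Section IndOfAlg.
Variables (K : closedFieldType) (G : algGroup K).

Fact ind_of_alg_variety : is_ind_variety (fun _ : nat => ag_atlas G).
Proof.
have [inj cl id_mor sep] := ag_variety G; split => [k|k|x].
- exact: ag_variety.
- split=> // i; have -> : pts (ag_atlas G) = setT.
    by apply/seteqP; split => x // _; apply: ag_full.
  by rewrite setTI.
- by exists 0; apply: ag_full.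
Qed.

Definition ind_of_alg : indGroup K :=
  IndGroup ind_of_alg_variety (fun=> ex_intro _ 0%N (@ag_mul K G))
    (fun=> ex_intro _ 0%N (@ag_inv K G)).

End IndOfAlg.

Section Torus.
Variables (K : closedFieldType) (m : nat).

Record torus_pt := TorusPt {
  tval :> 'rV[K]_m;
  tvalP : [forall i, tval 0 i != 0] }.

HB.instance Definition _ := [isSub for tval].
HB.instance Definition _ := [Choice of torus_pt by <:].

Implicit Types x y : torus_pt.

Lemma tval_neq0 x i : tval x 0 i != 0.
Proof. by have /forallP := tvalP x. Qed.

Fact torus_mulP x y :
  [forall i, (\row_j (tval x 0 j * tval y 0 j)) 0 i != 0].
Proof. by apply/forallP => i; rewrite mxE mulf_neq0 ?tval_neq0. Qed.
Definition torus_mul x y := TorusPt (torus_mulP x y).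

Fact torus_invP x : [forall i, (\row_j (tval x 0 j)^-1) 0 i != 0].
Proof. by apply/forallP => i; rewrite mxE invr_neq0 ?tval_neq0. Qed.
Definition torus_inv x := TorusPt (torus_invP x).

Fact torus_oneP : [forall i, (const_mx 1 : 'rV[K]_m) 0 i != 0].
Proof. by apply/forallP => i; rewrite mxE oner_neq0. Qed.
Definition torus_one := TorusPt torus_oneP.

Fact torus_mulA : associative torus_mul.
Proof. by move=> x y z; apply/val_inj/rowP => i; rewrite !mxE mulrA. Qed.
Fact torus_mul1 : left_id torus_one torus_mul.
Proof. by move=> x; apply/val_inj/rowP => i; rewrite !mxE mul1r. Qed.
Fact torus_mulr1 : right_id torus_one torus_mul.
Proof. by move=> x; apply/val_inj/rowP => i; rewrite !mxE mulr1. Qed.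
Fact torus_mulV : left_inverse torus_one torus_inv torus_mul.
Proof.
by move=> x; apply/val_inj/rowP => i; rewrite !mxE mulVf ?tval_neq0.
Qed.
Fact torus_mulrV : right_inverse torus_one torus_inv torus_mul.
Proof.
by move=> x; apply/val_inj/rowP => i; rewrite !mxE mulfV ?tval_neq0.
Qed.

HB.instance Definition _ := isGroup.Build torus_pt
  torus_mulA torus_mul1 torus_mulr1 torus_mulV torus_mulrV.

(* (K^* )^m is the closed subset x_i y_i = 1 of the affine space A^(2m). *)
Definition torus_atlas : atlas K torus_pt :=
  affine_atlas setT (fun x => row_mx (tval x) (tval (x^-1)%g)).

Fact torus_variety : is_variety torus_atlas.
Proof.
apply: (@one_chart_variety _ _ torus_atlas tt) => [[]//|x y _ _ /=|].
  by move=> /eq_row_mx[] /val_inj.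
apply: (zclosed_polyfun (F := fun (i : 'I_m) (z : 'rV_(m + m)) =>
   z 0 (lshift m i) * z 0 (rshift m i) - 1)) => [i|z] /=.
  by apply: polyfunB (polyfun_const _); apply: polyfunM; apply: polyfun_coord.
split=> [[x _ <-] i|H].
  by rewrite row_mxEl row_mxEr mxE mulfV ?subrr ?tval_neq0.
have H1 i : z 0 (lshift m i) * z 0 (rshift m i) = 1.
  by apply/eqP; rewrite -subr_eq0 H.
have nz : [forall i, lsubmx z 0 i != 0].
  apply/forallP => i; rewrite mxE; apply/eqP => z0.
  by have := H1 i; rewrite z0 mul0r => /eqP; rewrite eq_sym oner_eq0.
exists (TorusPt nz) => //=; rewrite -[RHS]hsubmxK; congr row_mx.
apply/rowP => i; rewrite !mxE; apply: (@mulfI _ (z 0 (lshift m i))).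
  by have /forallP/(_ i) := nz; rewrite mxE.
by rewrite H1 mulfV //; have /forallP/(_ i) := nz; rewrite mxE.
Qed.

Fact torus_full x : pts torus_atlas x.
Proof. by exists tt. Qed.

Fact torus_mul_morphism : morphism (prod_atlas torus_atlas torus_atlas)
  torus_atlas (fun xy => (xy.1 * xy.2)%g).
Proof.
apply: (@regular_on_poly _ _ _ _ _ torus_atlas _ tt) => [[]|x _|[[] []] l] //=.
exists (fun z => z 0 (lshift (m + m) l) * z 0 (rshift (m + m) l)).
  by apply: polyfunM; apply: polyfun_coord.
move=> [x y] _ _ /=; rewrite row_mxEl row_mxEr.
case: (split_ordP l) => i ->; rewrite ?row_mxEl ?row_mxEr !mxE //.
by rewrite invfM.
Qed.

Fact torus_inv_morphism :
  morphism torus_atlas torus_atlas (fun x => x^-1%g).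
Proof.
apply: (@regular_on_poly _ _ _ _ _ torus_atlas _ tt) => [[]|x _|[] l] //=.
case: (split_ordP l) => i ->.
  exists (fun z => z 0 (rshift m i)); first exact: polyfun_coord.
  by move=> x _ _; rewrite row_mxEl row_mxEr.
exists (fun z => z 0 (lshift m i)); first exact: polyfun_coord.
by move=> x _ _; rewrite row_mxEl row_mxEr !mxE invrK.
Qed.

Definition std_torus : algGroup K :=
  AlgGroup torus_variety torus_full torus_mul_morphism torus_inv_morphism.

End Torus.

Definition is_torus (K : closedFieldType) (T : algGroup K) : Prop :=
  exists m, alg_group_iso T (std_torus K m).

Record affineVariety (K : closedFieldType) := AffineVariety {
  adim : nat;
  apts : set 'rV[K]_adim;
  aclosed : zclosed apts }.
Arguments apts {K} a _ : rename.

Definition apoint (K : closedFieldType) (X : affineVariety K) : Type :=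
  {x | apts X x}.

Section CoordinateRing.
Variables (K : closedFieldType) (X : affineVariety K).
Notation n := (adim X).
Implicit Types (p q : {mpoly K[n]}) (f : apoint X -> K) (m : 'X_{1..n}).

Definition represents p f : Prop := forall x, f x = p.@[sval x 0].

Definition regular_fun f : Prop := exists p, represents p f.

(* O(X) is filtered by the images of the polynomials of degree at most d. *)
Definition regular_le d f : Prop :=
  exists2 p, (msize p <= d.+1)%N & represents p f.

(* Monomials whose restriction to X is not a linear combination of restrictions
   of smaller ones. The order of monomials refines the degree, so the
   standard monomials of degree at most d restrict to a basis of the functions
   in regular_le d. *)
Definition std_monomial m : Prop :=
  ~ exists2 q, (forall m', m' \in msupp q -> (m' < m)%O) &
      forall x, apts X x -> q.@[x 0] = ('X_[m]).@[x 0].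

Definition normal p : Prop := forall m, m \in msupp p -> std_monomial m.

(* The coefficients of normal_form f are the coordinates of f in the basis of
   O(X) formed by the standard monomials. *)
Definition normal_form f : {mpoly K[n]} :=
  xget 0 [set p | normal p /\ represents p f].

Lemma normal_monomial m : exists q, [/\ normal q,
  forall x, apts X x -> ('X_[m]).@[x 0] = q.@[x 0] &
  forall m', m' \in msupp q -> (m' <= m)%O].
Proof.
elim/(@ltmwf n): m => m IH;
 have [std|/contrapT[q0 q0lt q0E]] := pselect (std_monomial m).
  exists 'X_[m]; split=> // m'; rewrite msuppX inE => /eqP-> //.
have {IH} /choice[r rP] : forall m', exists q, (m' < m)%O -> [/\ normal q,
    forall x, apts X x -> ('X_[m']).@[x 0] = q.@[x 0] &
    forall m'', m'' \in msupp q -> (m'' <= m')%O].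
  move=> m'; have [lt|_] := boolP (m' < m)%O; last by exists 0.
  by have [q qP] := IH _ lt; exists q.
exists (\sum_(m' <- msupp q0) q0@_m' *: r m'); split.
- move=> m'' /msupp_sum_le; rewrite filter_predT => /flattenP[s /mapP[m' m'q ->]].
  by move=> /msuppZ_le; have [nr _ _] := rP _ (q0lt _ m'q); apply: nr.
- move=> x Xx; rewrite -q0E // [q0 in LHS]mpolyE !raddf_sum /=.
  apply: eq_big_seq => m' m'q; rewrite !mevalZ.
  by have [_ -> //] := rP _ (q0lt _ m'q).
- move=> m'' /msupp_sum_le; rewrite filter_predT => /flattenP[s /mapP[m' m'q ->]].
  move=> /msuppZ_le; have [_ _ ler] := rP _ (q0lt _ m'q) => /ler le1.
  exact: le_trans le1 (ltW (q0lt _ m'q)).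
Qed.

Lemma normal_exists p : exists q, [/\ normal q,
  forall x, apts X x -> p.@[x 0] = q.@[x 0] & (msize q <= msize p)%N].
Proof.
have /choice[r rP] := normal_monomial.
exists (\sum_(m' <- msupp p) p@_m' *: r m'); split.
- move=> m'' /msupp_sum_le; rewrite filter_predT => /flattenP[s /mapP[m' m'q ->]].
  by move=> /msuppZ_le; have [nr _ _] := rP m'; apply: nr.
- move=> x Xx; rewrite [p in LHS]mpolyE !raddf_sum /=.
  apply: eq_big_seq => m' m'q; rewrite !mevalZ.
  by have [_ -> //] := rP m'.
- rewrite msizeE; apply/bigmax_leqP_seq => m'' + _.
  move=> /msupp_sum_le; rewrite filter_predT => /flattenP[s /mapP[m' m'q ->]].
  move=> /msuppZ_le; have [_ _ ler] := rP m' => /ler /lemc_mdeg le1.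
  exact: leq_ltn_trans le1 (msize_mdeg_lt m'q).
Qed.

Lemma normal_eq0 p : normal p -> (forall x, apts X x -> p.@[x 0] = 0) -> p = 0.
Proof.
move=> np p0; apply/eqP/negPn/negP => pn0.
apply: (np _ (mlead_supp pn0)).
exists ('X_[mlead p] - (mleadc p)^-1 *: p) => [m|x Xx]; last first.
  by rewrite mevalB mevalZ p0 // mulr0 subr0.
rewrite mcoeff_msupp mcoeffB mcoeffZ mcoeffX.
case: (ltgtP m (mlead p)) => // [lt|->].
  by rewrite (mcoeff_gt_mlead lt) mulr0 subrr eqxx.
by rewrite mulVf ?mleadc_eq0 // subrr eqxx.
Qed.

Lemma normalB p q : normal p -> normal q -> normal (p - q).
Proof.
move=> np nq m /msuppB_le; rewrite mem_cat => /orP[]; [exact: np|exact: nq].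
Qed.

Lemma normal_inj p q f :
  normal p -> normal q -> represents p f -> represents q f -> p = q.
Proof.
move=> np nq rp rq; apply/eqP; rewrite -subr_eq0; apply/eqP.
apply: normal_eq0 (normalB np nq) _ => x Xx; rewrite mevalB.
by rewrite -(rp (exist _ x Xx)) -(rq (exist _ x Xx)) subrr.
Qed.

Lemma normal_formP f : regular_fun f ->
  normal (normal_form f) /\ represents (normal_form f) f.
Proof.
case=> p rp; have [q [nq pq _]] := normal_exists p.
apply: (@xgetI _ 0 [set p | normal p /\ represents p f] q); split=> //.
by move=> x; rewrite rp pq //; apply: svalP.
Qed.

Lemma normal_formE f p : normal p -> represents p f -> normal_form f = p.
Proof.
move=> np rp; have [nf rf] := normal_formP (ex_intro _ p rp).
exact: normal_inj rf rp.
Qed.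

Lemma regular_leW d f : regular_le d f -> regular_fun f.
Proof. by case=> p _ ?; exists p. Qed.

Lemma normal_form_msize d f : regular_le d f ->
  (msize (normal_form f) <= d.+1)%N.
Proof.
case=> p pd rp; have [q [nq pq qp]] := normal_exists p.
rewrite (@normal_formE _ q) //; first exact: leq_trans qp pd.
by move=> x; rewrite rp pq //; apply: svalP.
Qed.

Record endo := Endo {
  endo_fun :> apoint X -> apoint X;
  endo_regular : forall i, regular_fun (fun x => sval (endo_fun x) 0 i) }.

Definition endo_coord (a : endo) i : apoint X -> K := fun x => sval (a x) 0 i.

End CoordinateRing.

Section Automorphisms.
Variables (K : closedFieldType) (X : affineVariety K).
Notation n := (adim X).

(* The components endo_coord a i embed End(X) into O(X)^n. The d-th member of
   the filtration has all components in regular_le d, and its only chart lists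
   their coefficients on the standard monomials of degree at most d (those on
   the other monomials are zero). *)
Definition endo_chart d (a : endo X) :
    'rV[K]_#|{: 'I_n * 'X_{1..n < d.+1}}| :=
  \row_k (let im : 'I_n * 'X_{1..n < d.+1} := enum_val k in
          (normal_form (endo_coord a im.1))@_im.2).

Definition endo_atlas d : atlas K (endo X) :=
  affine_atlas [set a | forall i, regular_le d (endo_coord a i)]
    (endo_chart d).

Record aut := Aut {
  aut_fun :> endo X;
  aut_inv : endo X;
  aut_funK : cancel aut_fun aut_inv;
  aut_invK : cancel aut_inv aut_fun }.

(* Aut(X) is the subset of End(X) x End(X) of pairs of mutually inverse
   endomorphisms, with the induced filtration and structure. *)
Definition aut_pair (a : aut) : endo X * endo X := (aut_fun a, aut_inv a).

Definition aut_filt d : atlas K aut :=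
  pull_atlas aut_pair (prod_atlas (endo_atlas d) (endo_atlas d)).

Lemma apoint_eq (x y : apoint X) : sval x = sval y -> x = y.
Proof.
case: x y => [x Xx] [y Xy] /= xy; case: _ / xy Xy => Xx'.
by congr exist; apply: Prop_irrelevance.
Qed.

Lemma endo_eq (a b : endo X) : a =1 b -> a = b.
Proof.
case: a b => [a ra] [b rb] /= ab; have {}ab : a = b by apply/funext.
by case: _ / ab rb => rb; congr Endo; apply: Prop_irrelevance.
Qed.

Lemma aut_eq (a b : aut) : a =1 b -> a = b.
Proof.
case: a b => [a a' aK aK'] [b b' bK bK'] /= ab.
have {ab} ab : a = b by apply: endo_eq.
case: _ / ab bK bK' => bK bK'.
have ab' : a' = b' by apply: endo_eq => x; rewrite -[x in RHS]aK' bK.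
by case: _ / ab' bK bK' => bK bK'; congr Aut; apply: Prop_irrelevance.
Qed.

Fact endo_id_regular i : regular_fun (fun x : apoint X => sval x 0 i).
Proof. by exists 'X_i => x; rewrite mevalXU. Qed.
Definition endo_id : endo X := Endo endo_id_regular.

Fact endo_comp_regular (a b : endo X) i :
  regular_fun (fun x : apoint X => sval (a (b x)) 0 i).
Proof.
have [p pE] := endo_regular a i.
have /choice[q qE] := endo_regular b.
exists (p \mPo [tuple q j | j < n]) => x; rewrite pE comp_mpoly_meval.
by apply: meval_eq => j; rewrite tnth_mktuple -qE.
Qed.
Definition endo_comp a b : endo X := Endo (endo_comp_regular a b).

Definition aut_id := @Aut endo_id endo_id (fun=> erefl) (fun=> erefl).
Definition aut_comp (a b : aut) :=
  @Aut (endo_comp a b) (endo_comp (aut_inv b) (aut_inv a))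
    (can_comp (@aut_funK a) (@aut_funK b))
    (can_comp (@aut_invK b) (@aut_invK a)).
Definition aut_swap (a : aut) := Aut (@aut_invK a) (@aut_funK a).

HB.instance Definition _ := gen_eqMixin aut.
HB.instance Definition _ := gen_choiceMixin aut.

Fact aut_compA : associative aut_comp.
Proof. by move=> a b c; apply: aut_eq. Qed.
Fact aut_comp1 : left_id aut_id aut_comp.
Proof. by move=> a; apply: aut_eq. Qed.
Fact aut_compr1 : right_id aut_id aut_comp.
Proof. by move=> a; apply: aut_eq. Qed.
Fact aut_compV : left_inverse aut_id aut_swap aut_comp.
Proof. by move=> a; apply: aut_eq => x /=; rewrite aut_funK. Qed.
Fact aut_comprV : right_inverse aut_id aut_swap aut_comp.
Proof. by move=> a; apply: aut_eq => x /=; rewrite aut_invK. Qed.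

HB.instance Definition _ := isGroup.Build aut
  aut_compA aut_comp1 aut_compr1 aut_compV aut_comprV.

Lemma regular_leS d e (f : apoint X -> K) :
  (d <= e)%N -> regular_le d f -> regular_le e f.
Proof. by move=> de [p pd rp]; exists p => //; apply: leq_trans pd _. Qed.

Section Degree.
Variable d : nat.
Notation N := #|{: 'I_n * 'X_{1..n < d.+1}}|.
Implicit Type u : 'rV[K]_N.

Definition coef_poly u (i : 'I_n) : {mpoly K[n]} :=
  \sum_(m : 'X_{1..n < d.+1}) u 0 (enum_rank (i, m)) *: 'X_[m].

Lemma coef_polyE u i (m : 'X_{1..n < d.+1}) :
  (coef_poly u i)@_m = u 0 (enum_rank (i, m)).
Proof.
pose E m' := if insub m' is Some b then
  u 0 (enum_rank (i, b : 'X_{1..n < d.+1})) else 0.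
have -> : coef_poly u i = \sum_(m' : 'X_{1..n < d.+1}) E m' *: 'X_[m'].
  by apply: eq_bigr => m' _; rewrite /E valK.
by rewrite (mcoeff_mpoly E) ?bmdeg // /E valK.
Qed.

Lemma coef_poly_msize u i : (msize (coef_poly u i) <= d.+1)%N.
Proof.
apply: leq_trans (msize_sum _ _ _) _; apply/bigmax_leqP => m _.
by apply: leq_trans (msizeZ_le _ _) _; rewrite msizeX bmdeg.
Qed.

Lemma coef_poly_large u i m : (d < mdeg m)%N -> (coef_poly u i)@_m = 0.
Proof.
move=> dm; apply: memN_msupp_eq0; apply: msize_mdeg_ge.
exact: leq_trans (coef_poly_msize u i) dm.
Qed.

Lemma coef_poly_chart a i : regular_le d (endo_coord a i) ->
  coef_poly (endo_chart d a) i = normal_form (endo_coord a i).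
Proof.
move=> /normal_form_msize szf; apply/mpolyP => m.
case: (ltnP (mdeg m) d.+1) => dm.
  by have := coef_polyE (endo_chart d a) i (BMultinom dm); rewrite mxE enum_rankK.
rewrite coef_poly_large // memN_msupp_eq0 // msize_mdeg_ge //.
exact: leq_trans szf dm.
Qed.

Lemma endo_chartE a i (m : 'X_{1..n < d.+1}) :
  endo_chart d a 0 (enum_rank (i, m)) = (normal_form (endo_coord a i))@_m.
Proof. by rewrite mxE enum_rankK. Qed.

Lemma endo_chart_eval a i x : regular_le d (endo_coord a i) ->
  sval (a x) 0 i = (coef_poly (endo_chart d a) i).@[sval x 0].
Proof.
move=> ra; rewrite coef_poly_chart //.
by have [_ <-] := normal_formP (regular_leW ra).
Qed.

Definition endo_coef u : Prop := (forall i, normal (coef_poly u i)) /\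
  forall x, apts X x -> apts X (\row_i (coef_poly u i).@[x 0]).

Lemma endo_chart_coef a : dom (endo_atlas d) tt a -> endo_coef (endo_chart d a).
Proof.
move=> /= ra; split=> [i|x Xx].
  by rewrite coef_poly_chart //; case: (normal_formP (regular_leW (ra i))).
have := svalP (a (exist _ x Xx)); congr (apts X _).
by apply/rowP => i; rewrite mxE endo_chart_eval.
Qed.

Lemma endo_coef_chart u : endo_coef u ->
  exists2 a, dom (endo_atlas d) tt a & endo_chart d a = u.
Proof.
move=> [nu Xu].
pose a0 (x : apoint X) : apoint X := exist _ _ (Xu _ (svalP x)).
have rep i : represents (coef_poly u i) (fun x => sval (a0 x) 0 i).
  by move=> x /=; rewrite mxE.
have reg i : regular_fun (fun x => sval (a0 x) 0 i) by exists (coef_poly u i).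
exists (Endo reg).
  by move=> i; exists (coef_poly u i); [apply: coef_poly_msize | apply: rep].
apply/rowP => k; rewrite -[k]enum_valK; case: (enum_val k) => i m.
rewrite endo_chartE (@normal_formE _ _ _ (coef_poly u i)) ?coef_polyE //.
Qed.

Lemma endo_chart_inj a b : dom (endo_atlas d) tt a -> dom (endo_atlas d) tt b ->
  endo_chart d a = endo_chart d b -> a = b.
Proof.
move=> ra rb ab; apply: endo_eq => x; apply/apoint_eq/rowP => i.
by rewrite [LHS]endo_chart_eval // ab -endo_chart_eval.
Qed.

Lemma normal_form_polyfun i m : exists2 g, polyfun g &
  forall a, dom (endo_atlas d) tt a ->
    (normal_form (endo_coord a i))@_m = g (endo_chart d a).
Proof.
case: (ltnP (mdeg m) d.+1) => dm.
  exists (fun u => u 0 (enum_rank (i, BMultinom dm))) => [|a ra].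
    exact: polyfun_coord.
  by rewrite endo_chartE.
exists (fun=> 0) => [|a ra]; first exact: polyfun_const.
by rewrite -coef_poly_chart // coef_poly_large.
Qed.

Lemma polyfun_coef_poly M (phi : 'rV[K]_M -> 'rV[K]_N) i
    (e : 'I_n -> 'rV[K]_M -> K) :
  (forall k, polyfun (fun z => phi z 0 k)) -> (forall j, polyfun (e j)) ->
  polyfun (fun z => (coef_poly (phi z) i).@[e ^~ z]).
Proof.
move=> pphi pe; apply: (@polyfun_ext _ _ (fun z => \sum_(m : 'X_{1..n < d.+1})
    phi z 0 (enum_rank (i, m)) * ('X_[m]).@[e ^~ z])) => [z|].
  by rewrite raddf_sum; apply: eq_bigr => m _; rewrite /= mevalZ.
by apply: polyfun_sum => m; apply: polyfunM => //; apply: polyfun_meval.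
Qed.

Lemma zclosed_endo_coef M (phi : 'rV[K]_M -> 'rV[K]_N) :
  (forall k, polyfun (fun z => phi z 0 k)) ->
  zclosed [set z | endo_coef (phi z)].
Proof.
move=> pphi; have [S SP] := zclosedE (aclosed X).
pose J := ({im : 'I_n * 'X_{1..n < d.+1} | ~ std_monomial (X := X) im.2} +
           {x | apts X x} * {p | S p})%type.
pose F (j : J) (z : 'rV[K]_M) := match j with
  | inl im => phi z 0 (enum_rank (sval im))
  | inr xp => (sval xp.2).@[fun i => (coef_poly (phi z) i).@[sval xp.1 0]]
  end.
apply: (zclosed_polyfun (F := F)) => [[im|[x p]]|z] /=.
- exact: pphi.
- apply: polyfun_meval => i; apply: polyfun_coef_poly => // j.
  exact: polyfun_const.
- have ev x p : p.@[(\row_i (coef_poly (phi z) i).@[x 0]) 0] =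
      p.@[fun i => (coef_poly (phi z) i).@[x 0]].
    by apply: meval_eq => i; rewrite mxE.
  split=> [[nz Xz] [[[i m] nm]|[[x Xx] [p Sp]]] /=|H].
  + rewrite -coef_polyE memN_msupp_eq0 //; apply/negP => /nz; exact: nm.
  + by rewrite -ev; apply: (SP _).1 Sp; apply: Xz.
  + split=> [i m|x Xx].
      apply: contraPP => nm; apply/negP; rewrite -mcoeff_eq0.
      case: (ltnP (mdeg m) d.+1) => dm; last by rewrite coef_poly_large.
      rewrite (coef_polyE (phi z) i (BMultinom dm)).
      by apply/eqP; apply: (H (inl (exist _ (i, BMultinom dm) nm))).
    apply/SP => p Sp; rewrite ev.
    exact: (H (inr (exist _ x Xx, exist _ p Sp))).
Qed.

End Degree.

Definition aut_coef d (w : 'rV[K]_(#|{: 'I_n * 'X_{1..n < d.+1}}| +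
    #|{: 'I_n * 'X_{1..n < d.+1}}|)) : Prop :=
  [/\ endo_coef (lsubmx w), endo_coef (rsubmx w) &
    forall x i, apts X x ->
    (coef_poly (lsubmx w) i).@[fun j => (coef_poly (rsubmx w) j).@[x 0]] = x 0 i
    /\
    (coef_poly (rsubmx w) i).@[fun j => (coef_poly (lsubmx w) j).@[x 0]] = x 0 i].

Lemma polyfun_lsub m1 m2 k : polyfun (fun z : 'rV[K]_(m1 + m2) => lsubmx z 0 k).
Proof.
by apply: polyfun_ext (polyfun_coord (lshift m2 k)) => z; rewrite mxE.
Qed.

Lemma polyfun_rsub m1 m2 k : polyfun (fun z : 'rV[K]_(m1 + m2) => rsubmx z 0 k).
Proof.
by apply: polyfun_ext (polyfun_coord (rshift m1 k)) => z; rewrite mxE.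
Qed.

Lemma polyfun_subst m1 m2 (g : 'rV[K]_m2 -> K) (phi : 'rV[K]_m1 -> 'rV[K]_m2) :
  polyfun g -> (forall k, polyfun (fun z => phi z 0 k)) ->
  polyfun (fun z => g (phi z)).
Proof.
move=> [p pE] pphi; apply: (polyfun_ext (f := fun z => p.@[phi z 0])) => [z|].
  by rewrite pE.
exact: (polyfun_meval p (e := fun k z => phi z 0 k)).
Qed.

Lemma aut_chart_image d :
  [set @chart K aut (aut_filt d) (tt, tt) a | a in dom (aut_filt d) (tt, tt)] =
  [set w | aut_coef w].
Proof.
apply/seteqP; split=> [_ [a [/= ra rb] <-]|w [cl cr lr]] /=.
  rewrite /aut_coef row_mxKl row_mxKr; split; try exact: endo_chart_coef.
  move=> x i Xx; pose y : apoint X := exist _ x Xx; split.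
    transitivity (sval (aut_fun a (aut_inv a y)) 0 i); last by rewrite aut_invK.
    by rewrite (@endo_chart_eval d) //; apply: meval_eq => j; rewrite (@endo_chart_eval d).
  transitivity (sval (aut_inv a (aut_fun a y)) 0 i); last by rewrite aut_funK.
  by rewrite (@endo_chart_eval d) //; apply: meval_eq => j; rewrite (@endo_chart_eval d).
have [a ra aE] := endo_coef_chart cl; have [b rb bE] := endo_coef_chart cr.
have ab : cancel a b.
  move=> x; apply/apoint_eq/rowP => i; rewrite (@endo_chart_eval d) // bE.
  rewrite -[RHS](lr (sval x) i (svalP x)).2; apply: meval_eq => j.
  by rewrite (@endo_chart_eval d) // aE.
have ba : cancel b a.
  move=> x; apply/apoint_eq/rowP => i; rewrite (@endo_chart_eval d) // aE.
  rewrite -[RHS](lr (sval x) i (svalP x)).1; apply: meval_eq => j.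
  by rewrite (@endo_chart_eval d) // bE.
by exists (Aut ab ba) => //=; rewrite aE bE hsubmxK.
Qed.

Lemma zclosed_aut_coef d : zclosed [set w | @aut_coef d w].
Proof.
rewrite (_ : [set w | _] = [set w | (endo_coef (lsubmx w) /\ endo_coef (rsubmx w))
  /\ forall xi : {x | apts X x} * 'I_n,
    (coef_poly (lsubmx w) xi.2).@[fun j => (coef_poly (rsubmx w) j).@[sval xi.1 0]]
      = sval xi.1 0 xi.2 /\
    (coef_poly (rsubmx w) xi.2).@[fun j => (coef_poly (lsubmx w) j).@[sval xi.1 0]]
      = sval xi.1 0 xi.2]); last first.
  apply/seteqP; split=> w /= [].
    by move=> cl cr H; split=> // -[[x Xx] i]; apply: H.
  by move=> [cl cr] H; split=> // x i Xx; apply: (H (exist _ x Xx, i)).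
have pl := @polyfun_lsub; have pr := @polyfun_rsub.
apply: zclosed_and.
  by apply: zclosed_and; apply: zclosed_endo_coef.
apply: zclosed_forall => -[x i] /=; apply: zclosed_and;
  (apply: zclosed_eq; last exact: polyfun_const);
  apply: polyfun_coef_poly => // j; apply: polyfun_coef_poly => // k;
  exact: polyfun_const.
Qed.

Lemma aut_variety d : is_variety (aut_filt d).
Proof.
apply: (@one_chart_variety _ _ (aut_filt d) (tt, tt)).
- by move=> [[] []].
- move=> a b [/= ra ra'] [rb rb'] /eq_row_mx[/endo_chart_inj ab _].
  by apply: aut_eq => x; rewrite ab.
- by rewrite aut_chart_image; apply: zclosed_aut_coef.
Qed.

Lemma pts_aut d a : pts (aut_filt d) a <-> dom (aut_filt d) (tt, tt) a.
Proof. by split=> [[[[] []]]|ra] //; exists (tt, tt). Qed.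

(* A map into aut_filt e is a morphism as soon as all the coefficients of its
   two components are polynomial functions in the charts of the source. *)
Lemma regular_on_aut S (A : set S) (V : atlas K S) e (f : S -> aut) :
  (forall x, A x -> dom (aut_filt e) (tt, tt) (f x)) ->
  (forall v i m, exists2 g, polyfun g & forall x, A x -> dom V v x ->
     (normal_form (endo_coord (aut_fun (f x)) i))@_m = g (@chart K S V v x)) ->
  (forall v i m, exists2 g, polyfun g & forall x, A x -> dom V v x ->
     (normal_form (endo_coord (aut_inv (f x)) i))@_m = g (@chart K S V v x)) ->
  regular_on A V (aut_filt e) f.
Proof.
move=> fA fP fP'; apply: (@regular_on_poly _ _ _ _ _ (aut_filt e) _ (tt, tt)).
- by move=> [[] []].
- exact: fA.
move=> v l /=; case: (split_ordP l) => k -> {l}.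
  rewrite -[k]enum_valK; case: (enum_val k) => i m.
  have [g pg gE] := fP v i m; exists g => // x Ax vx.
  by rewrite row_mxEl endo_chartE gE.
rewrite -[k]enum_valK; case: (enum_val k) => i m.
have [g pg gE] := fP' v i m; exists g => // x Ax vx.
by rewrite row_mxEr endo_chartE gE.
Qed.

Lemma aut_fun_polyfun d i m : exists2 g, polyfun g &
  forall a, dom (aut_filt d) (tt, tt) a ->
  (normal_form (endo_coord (aut_fun a) i))@_m =
    g (@chart K aut (aut_filt d) (tt, tt) a).
Proof.
have [g pg gE] := @normal_form_polyfun d i m.
exists (fun z => g (lsubmx z)) => [|a [/= ra _]].
  by apply: polyfun_subst => // k; apply: polyfun_lsub.
by rewrite row_mxKl gE.
Qed.

Lemma aut_inv_polyfun d i m : exists2 g, polyfun g &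
  forall a, dom (aut_filt d) (tt, tt) a ->
  (normal_form (endo_coord (aut_inv a) i))@_m =
    g (@chart K aut (aut_filt d) (tt, tt) a).
Proof.
have [g pg gE] := @normal_form_polyfun d i m.
exists (fun z => g (rsubmx z)) => [|a [/= _ ra]].
  by apply: polyfun_subst => // k; apply: polyfun_rsub.
by rewrite row_mxKr gE.
Qed.

Lemma endo_dom_lower d a : dom (endo_atlas d.+1) tt a ->
  dom (endo_atlas d) tt a <->
  forall im : 'I_n * 'X_{1..n < d.+2}, mdeg im.2 = d.+1 ->
    endo_chart d.+1 a 0 (enum_rank im) = 0.
Proof.
move=> ra; split=> [rd [i m] /= dm|H i].
  rewrite endo_chartE memN_msupp_eq0 // msize_mdeg_ge // dm.
  exact: normal_form_msize (rd i).
have [_ rf] := normal_formP (regular_leW (ra i)).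
exists (normal_form (endo_coord a i)) => //.
rewrite msizeE; apply/bigmax_leqP_seq => m mf _.
have := leq_trans (msize_mdeg_lt mf) (normal_form_msize (ra i)).
rewrite ltnS leq_eqVlt => /orP[/eqP dm|//].
have dm' : (mdeg m < d.+2)%N by rewrite dm.
have := H (i, BMultinom dm') dm; rewrite endo_chartE => /eqP.
by rewrite mcoeff_eq0 mf.
Qed.

Lemma aut_subvariety d : closed_subvariety (aut_filt d) (aut_filt d.+1).
Proof.
have sub a : dom (aut_filt d) (tt, tt) a -> dom (aut_filt d.+1) (tt, tt) a.
  by move=> [/= ra rb]; split=> i /=; apply: (@regular_leS d) => //.
split.
- by move=> a /pts_aut/sub; exists (tt, tt).
- move=> [[] []]; rewrite (_ : [set _ | _ in _] = [set w |
    aut_coef w /\ forall im : {im : 'I_n * 'X_{1..n < d.+2} | mdeg im.2 = d.+1},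
      lsubmx w 0 (enum_rank (sval im)) = 0 /\
      rsubmx w 0 (enum_rank (sval im)) = 0]).
    apply: zclosed_and; first exact: zclosed_aut_coef.
    apply: zclosed_forall => im.
    by apply: zclosed_and; apply: zclosed_eq (polyfun_const _);
      [apply: polyfun_lsub | apply: polyfun_rsub].
  apply/seteqP; split=> w.
    move=> [a [/pts_aut [/= ra rb] /[dup] sa [/= sra srb]] <-]; split.
      suff : [set w | aut_coef w] (@chart K aut (aut_filt d.+1) (tt, tt) a) by [].
      by rewrite -aut_chart_image; exists a.
    move=> [im dm]; rewrite row_mxKl row_mxKr /=.
    by split; [apply: (endo_dom_lower sra).1 | apply: (endo_dom_lower srb).1].
  move=> [aw wH].
  have : [set w | aut_coef w] w by [].
  rewrite -aut_chart_image => -[a [/= ra rb] aE].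
  exists a => //; split; last by split.
  move: wH; rewrite -aE row_mxKl row_mxKr => wH.
  apply/pts_aut; split=> /=.
    apply: (endo_dom_lower ra).2 => im dm.
    exact: (wH (exist _ im dm)).1.
  apply: (endo_dom_lower rb).2 => im dm.
  exact: (wH (exist _ im dm)).2.
- apply: regular_on_aut => [a /pts_aut/sub //|[[] []] i m|[[] []] i m].
    have [g pg gE] := aut_fun_polyfun d i m.
    by exists g => // a _ ra; apply: gE.
  have [g pg gE] := aut_inv_polyfun d i m.
  by exists g => // a _ ra; apply: gE.
- apply: regular_on_aut => [a /pts_aut //|[[] []] i m|[[] []] i m].
    have [g pg gE] := aut_fun_polyfun d.+1 i m.
    by exists g => // a _ ra; apply: gE.
  have [g pg gE] := aut_inv_polyfun d.+1 i m.
  by exists g => // a _ ra; apply: gE.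
Qed.

Lemma endo_exhaust (a : endo X) : exists d, dom (endo_atlas d) tt a.
Proof.
have /choice[p pE] := endo_regular a.
exists (\max_i msize (p i)) => i; exists (p i); last exact: pE.
by apply: leqW; apply: leq_bigmax.
Qed.

Lemma aut_ind_variety : is_ind_variety aut_filt.
Proof.
split; [exact: aut_variety | exact: aut_subvariety|] => a.
have [d ra] := endo_exhaust (aut_fun a); have [e rb] := endo_exhaust (aut_inv a).
exists (maxn d e); apply/pts_aut; split=> i /=.
  exact: regular_leS (leq_maxl _ _) (ra i).
exact: regular_leS (leq_maxr _ _) (rb i).
Qed.

Lemma aut_swap_morphism : ind_morphism aut_filt aut_filt (fun a => a^-1%g).
Proof.
move=> d; exists d; apply: regular_on_aut => [a /pts_aut[ra rb]|[[] []] i m|[[] []] i m].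
- by split.
- have [g pg gE] := aut_inv_polyfun d i m.
  by exists g => // a _ ra; apply: gE.
- have [g pg gE] := aut_fun_polyfun d i m.
  by exists g => // a _ ra; apply: gE.
Qed.

(* A family of polynomials parametrised by A^M, with bounded degrees and
   coefficients polynomial in the parameter. *)
Definition polyfam M (c : 'rV[K]_M -> {mpoly K[n]}) : Prop :=
  (exists D, forall z, (msize (c z) <= D)%N) /\
  forall m, polyfun (fun z => (c z)@_m).

Lemma polyfam_ext M (b c : 'rV[K]_M -> {mpoly K[n]}) :
  b =1 c -> polyfam b -> polyfam c.
Proof. by move=> /funext->. Qed.

Lemma polyfam_const M p : polyfam (fun _ : 'rV[K]_M => p).
Proof. by split=> [|m]; [exists (msize p) | apply: polyfun_const]. Qed.

Lemma polyfamZ M (f : 'rV[K]_M -> K) c :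
  polyfun f -> polyfam c -> polyfam (fun z => f z *: c z).
Proof.
move=> pf [[D cD] pc]; split=> [|m].
  by exists D => z; apply: leq_trans (msizeZ_le _ _) (cD z).
by apply: polyfun_ext (polyfunM pf (pc m)) => z; rewrite mcoeffZ.
Qed.

Lemma polyfamD M (b c : 'rV[K]_M -> {mpoly K[n]}) :
  polyfam b -> polyfam c -> polyfam (fun z => b z + c z).
Proof.
move=> [[D bD] pb] [[E cE] pc]; split=> [|m].
  exists (maxn D E) => z; apply: leq_trans (msizeD_le _ _) _.
  by rewrite geq_max !leq_max bD cE orbT.
by apply: polyfun_ext (polyfunD (pb m) (pc m)) => z; rewrite mcoeffD.
Qed.

Lemma polyfamM M (b c : 'rV[K]_M -> {mpoly K[n]}) :
  polyfam b -> polyfam c -> polyfam (fun z => b z * c z).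
Proof.
move=> [[D bD] pb] [[E cE] pc]; split=> [|m].
  exists (D + E).+1 => z; apply: leq_trans (msizeM_le _ _) _.
  by rewrite ltnS leq_add.
apply: (@polyfun_ext _ _ (fun z => \sum_(k <- index_enum
    ('X_{1..n < maxn D E} * 'X_{1..n < maxn D E})%type)
    (b z)@_k.1 * (c z)@_k.2 * (m == (k.1 + k.2)%MM)%:R)) => [z|].
  rewrite (@mpolywME _ _ _ _ (maxn D E)).
  - rewrite raddf_sum; apply: eq_bigr => k _ /=.
    by rewrite mcoeffZ mcoeffX eq_sym.
  - by apply: leq_trans (bD z) _; rewrite leq_maxl.
  - by apply: leq_trans (cE z) _; rewrite leq_maxr.
apply: polyfun_sum => k; apply: polyfunM; last exact: polyfun_const.
exact: polyfunM.
Qed.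

Lemma polyfam_sum M I (r : seq I) (F : I -> 'rV[K]_M -> {mpoly K[n]}) :
  (forall i, polyfam (F i)) -> polyfam (fun z => \sum_(i <- r) F i z).
Proof.
move=> pF; elim: r => [|i r IH].
  by apply: polyfam_ext (polyfam_const _ 0) => z; rewrite big_nil.
by apply: polyfam_ext (polyfamD (pF i) IH) => z; rewrite big_cons.
Qed.

Lemma polyfam_prod M I (r : seq I) (F : I -> 'rV[K]_M -> {mpoly K[n]}) :
  (forall i, polyfam (F i)) -> polyfam (fun z => \prod_(i <- r) F i z).
Proof.
move=> pF; elim: r => [|i r IH].
  by apply: polyfam_ext (polyfam_const _ 1) => z; rewrite big_nil.
by apply: polyfam_ext (polyfamM (pF i) IH) => z; rewrite big_cons.
Qed.

Lemma polyfamX M (c : 'rV[K]_M -> {mpoly K[n]}) k :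
  polyfam c -> polyfam (fun z => c z ^+ k).
Proof.
move=> pc; elim: k => [|k IH]; first exact: polyfam_const.
by apply: polyfam_ext (polyfamM pc IH) => z; rewrite exprS.
Qed.

Lemma polyfam_coef_poly M d (phi : 'rV[K]_M -> 'rV[K]_#|{: 'I_n * 'X_{1..n < d.+1}}|) i :
  (forall k, polyfun (fun z => phi z 0 k)) ->
  polyfam (fun z => coef_poly (phi z) i).
Proof.
move=> pphi; apply: polyfam_sum => m.
by apply: polyfamZ => //; apply: polyfam_const.
Qed.

Lemma polyfam_comp M d e
    (phi : 'rV[K]_M -> 'rV[K]_#|{: 'I_n * 'X_{1..n < d.+1}}|)
    (psi : 'rV[K]_M -> 'rV[K]_#|{: 'I_n * 'X_{1..n < e.+1}}|) i :
  (forall k, polyfun (fun z => phi z 0 k)) ->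
  (forall k, polyfun (fun z => psi z 0 k)) ->
  polyfam (fun z => coef_poly (phi z) i \mPo [tuple coef_poly (psi z) j | j < n]).
Proof.
move=> pphi ppsi; apply: (@polyfam_ext _ (fun z => \sum_(m : 'X_{1..n < d.+1})
  phi z 0 (enum_rank (i, m)) *: \prod_j coef_poly (psi z) j ^+ m j)) => [z|].
  rewrite (comp_mpolywE _ (coef_poly_msize (phi z) i)).
  apply: eq_bigr => m _; rewrite coef_polyE; congr (_ *: _).
  by apply: eq_bigr => j _; rewrite tnth_mktuple.
apply: polyfam_sum => m; apply: polyfamZ => //; apply: polyfam_prod => j.
by apply: polyfamX; apply: polyfam_coef_poly.
Qed.

Lemma normal_formZD (k : K) (p q : {mpoly K[n]}) :
  let r (p : {mpoly K[n]}) (x : apoint X) := p.@[sval x 0] in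
  normal_form (r (k *: p + q)) = k *: normal_form (r p) + normal_form (r q).
Proof.
move=> r; have rP p' : regular_fun (r p') by exists p'.
have [np rp] := normal_formP (rP p); have [nq rq] := normal_formP (rP q).
apply: normal_formE => [m|x].
  by move=> /msuppD_le; rewrite mem_cat => /orP[/msuppZ_le/np|/nq].
by rewrite /r !mevalD !mevalZ -rp -rq.
Qed.

Lemma polyfam_normal_form M (c : 'rV[K]_M -> {mpoly K[n]}) m : polyfam c ->
  polyfun (fun z => (normal_form (fun x : apoint X => (c z).@[sval x 0]))@_m).
Proof.
move=> [[D cD] pc].
pose nf p := normal_form (fun x : apoint X => p.@[sval x 0]).
have nfD k p q : nf (k *: p + q) = k *: nf p + nf q by apply: normal_formZD.
have nf0 : nf 0 = 0 by have := nfD (-1) 0 0; rewrite !scaleN1r oppr0 add0r addNr.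
apply: (@polyfun_ext _ _ (fun z => \sum_(m' <- index_enum 'X_{1..n < D})
   (c z)@_m' * (nf 'X_[m'])@_m)) => [z|].
  rewrite -/(nf (c z)) [in RHS](mpolywE (cD z)).
  elim: (index_enum _) => [|m' r IH]; first by rewrite !big_nil nf0 mcoeff0.
  by rewrite !big_cons nfD mcoeffD mcoeffZ IH.
by apply: polyfun_sum => m'; apply: polyfunM => //; apply: polyfun_const.
Qed.

Lemma endo_comp_polyfun d e M
    (phi : 'rV[K]_M -> 'rV[K]_#|{: 'I_n * 'X_{1..n < d.+1}}|)
    (psi : 'rV[K]_M -> 'rV[K]_#|{: 'I_n * 'X_{1..n < e.+1}}|) :
  (forall k, polyfun (fun z => phi z 0 k)) ->
  (forall k, polyfun (fun z => psi z 0 k)) ->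
  exists D, (forall z a b, dom (endo_atlas d) tt a -> dom (endo_atlas e) tt b ->
      endo_chart d a = phi z -> endo_chart e b = psi z ->
      dom (endo_atlas D) tt (endo_comp a b)) /\
  forall i m, exists2 g, polyfun g & forall z a b,
    dom (endo_atlas d) tt a -> dom (endo_atlas e) tt b ->
    endo_chart d a = phi z -> endo_chart e b = psi z ->
    (normal_form (endo_coord (endo_comp a b) i))@_m = g z.
Proof.
move=> pphi ppsi; have pc i := polyfam_comp i pphi ppsi.
pose c z i := coef_poly (phi z) i \mPo [tuple coef_poly (psi z) j | j < n].
have cE z a b i : dom (endo_atlas d) tt a -> dom (endo_atlas e) tt b ->
    endo_chart d a = phi z -> endo_chart e b = psi z ->
    endo_coord (endo_comp a b) i = fun x => (c z i).@[sval x 0].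
  move=> ra rb aE bE; apply/funext => x; rewrite /endo_coord /=.
  rewrite (@endo_chart_eval d) // aE comp_mpoly_meval; apply: meval_eq => j.
  by rewrite (@endo_chart_eval e) // bE tnth_mktuple.
have /choice[D DP] : forall i, exists D, forall z, (msize (c z i) <= D)%N.
  by move=> i; case: (pc i).
exists (\max_i D i); split=> [z a b ra rb aE bE i|i m].
  exists (c z i) => [|x]; last by rewrite (cE z).
  by apply: leqW; apply: leq_trans (DP i z) _; apply: leq_bigmax.
exists (fun z => (normal_form (fun x : apoint X => (c z i).@[sval x 0]))@_m).
  exact: polyfam_normal_form (pc i).
by move=> z a b ra rb aE bE; rewrite (cE z).
Qed.

Lemma aut_comp_morphism : ind_morphism (fun d => prod_atlas (aut_filt d) (aut_filt d))
  aut_filt (fun ab => (ab.1 * ab.2)%g).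
Proof.
move=> d; pose N := #|{: 'I_n * 'X_{1..n < d.+1}}|.
have psub (phi psi : forall k, 'rV[K]_(k + k) -> 'rV[K]_k) :
    (forall k l, polyfun (fun z => phi k z 0 l)) ->
    (forall k l, polyfun (fun z => psi k z 0 l)) ->
    forall l, polyfun (fun z : 'rV[K]_((N + N) + (N + N)) => psi N (phi (N + N)%N z) 0 l).
  by move=> pphi ppsi l; apply: (@polyfun_subst _ _ (fun y => psi N y 0 l)).
pose L k : 'rV[K]_(k + k) -> 'rV[K]_k := lsubmx.
pose R k : 'rV[K]_(k + k) -> 'rV[K]_k := rsubmx.
have pL k l : polyfun (fun z => L k z 0 l) by apply: polyfun_lsub.
have pR k l : polyfun (fun z => R k z 0 l) by apply: polyfun_rsub.
have [D [DP gP]] := endo_comp_polyfun (psub L L pL pL) (psub R L pR pL).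
have [E [EP hP]] := endo_comp_polyfun (psub R R pR pR) (psub L R pL pR).
exists (maxn D E); apply: regular_on_aut => [[a b] [[[[] []] [[] []]]]|v i m|v i m].
- move=> [/= [/= ra ra'] [/= rb rb']]; pose z := row_mx
    (row_mx (endo_chart d (aut_fun a)) (endo_chart d (aut_inv a)))
    (row_mx (endo_chart d (aut_fun b)) (endo_chart d (aut_inv b))).
  split=> i /=.
    apply: regular_leS (leq_maxl _ _) _.
    by apply: (DP z (aut_fun a) (aut_fun b)) => //; rewrite /L /R /z ?row_mxKl ?row_mxKr ?row_mxKl.
  apply: regular_leS (leq_maxr _ _) _.
  by apply: (EP z (aut_inv b) (aut_inv a)) => //; rewrite /L /R /z ?row_mxKl ?row_mxKr ?row_mxKl ?row_mxKr.
- case: v => [[[] []] [[] []]]; have [g pg gE] := gP i m.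
  exists g => // -[a b] _ [/= [/= ra ra'] [/= rb rb']].
  by apply: gE => //; rewrite /L /R ?row_mxKl ?row_mxKr ?row_mxKl.
- case: v => [[[] []] [[] []]]; have [g pg gE] := hP i m.
  exists g => // -[a b] _ [/= [/= ra ra'] [/= rb rb']].
  by apply: gE => //; rewrite /L /R ?row_mxKl ?row_mxKr ?row_mxKl ?row_mxKr.
Qed.

Definition Aut_ind_group : indGroup K :=
  IndGroup aut_ind_variety aut_comp_morphism aut_swap_morphism.

End Automorphisms.

(* Main.v *)
Require Import Defs.
From mathcomp Require Import all_boot all_order all_algebra.
From mathcomp Require Import boolp classical_sets mpoly.
From mathcomp Require Import zify.

(** For [T] of dimension [m], take for [X] the union of the cusps
    [c_i(t) = (t^2, t^(2i+3))], [0 <= i < m], the [i]-th one lying in the [i]-th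
    coordinate plane of [(A^2)^m], so that they all meet at the origin only.
    Restricted to a branch, an automorphism has polynomial components [P_j, Q_j]
    with [P_i P_j = 0] for [i <> j] and [Q_j^2 = P_j^(2j+3)]; by divisibility in
    [K[t]] it is [t |-> c_j(r(t))] for a single [j] and a polynomial [r], and the
    inverse automorphism forces [deg r = 1]. As [r^2] and [r^(2j+3)] lie in
    [K[t^2, t^(2i+3)]], which has no monomial of odd degree below [2i+3], [r] has
    no constant term (here char 0 is used) and [i <= j], whence [i = j] by
    symmetry. So automorphisms are [c_i(t) |-> c_i(a_i t)] with [a] in the torus. *)

Set Implicit Arguments.
Unset Strict Implicit.
Unset Printing Implicit Defensive.

Import GRing.Theory.

Local Open Scope classical_set_scope.
Local Open Scope ring_scope.

Section Composition.
Variable K : closedFieldType.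

Lemma meval_frac n k (q : {mpoly K[k]}) (p : 'I_k -> {mpoly K[n]})
    (h : {mpoly K[n]}) N : (msize q <= N)%N ->
  exists r : {mpoly K[n]}, forall z : 'I_n -> K, h.@[z] != 0 ->
    q.@[fun l => (p l).@[z] / h.@[z]] = r.@[z] / h.@[z] ^+ N.
Proof.
move=> qN; exists (\sum_(m <- msupp q)
  q@_m *: (\prod_i p i ^+ m i * h ^+ (N - mdeg m))) => z hz.
rewrite mevalE raddf_sum /= mulr_suml; apply: eq_big_seq => m mq.
rewrite mevalZ mevalM rmorph_prod rmorphXn -!mulrA; congr (_ * _).
have -> : \prod_i ((p i).@[z] / h.@[z]) ^+ m i =
    \prod_i (p i ^+ m i).@[z] / h.@[z] ^+ mdeg m.
  rewrite mdegE -prodrXr -prodf_div; apply: eq_bigr => i _.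
  by rewrite expr_div_n rmorphXn.
congr (_ * _).
have mq' : (mdeg m <= N)%N by apply: leq_trans qN; apply/ltnW/msize_mdeg_lt.
apply: (mulIf (expf_neq0 N hz)).
by rewrite divfK ?expf_neq0 // mulrC -{1}(subnK mq') exprD mulfK ?expf_neq0.
Qed.

Lemma morphism_comp T S U (V : atlas K T) (W : atlas K S) (Z : atlas K U) f g :
  morphism V W f -> morphism W Z g -> morphism V Z (g \o f).
Proof.
move=> fP gP x Vx; have [/[dup] Wfx [j jfx] fx] := fP _ Vx.
have [Zgfx gfx] := gP _ Wfx; split=> // i l ix lgfx.
have [h [p [hx hp]]] := fx i j ix jfx.
have [k [q [kx kq]]] := gfx j l jfx lgfx.
have fE y : pts V y -> dom V i y -> h.@[chart i y 0] != 0 ->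
    chart j (f y) 0 =1 fun l => (p l).@[chart i y 0] / h.@[chart i y 0].
  by move=> Vy iy hy e; have [_ ->] := hp y Vy iy hy.
pose N := (maxn (msize k) (\max_e msize (q e)))%N.
have [k' k'E] := meval_frac p h (leq_maxl _ _ : (msize k <= N)%N).
have qN e : (msize (q e) <= N)%N by rewrite leq_max leq_bigmax orbT.
have /choice[q' q'E] := fun e => meval_frac p h (qN e).
exists (h * k'), (fun e => h * q' e); split.
  rewrite mevalM mulf_neq0 //; apply: contraNneq kx => k'0.
  by rewrite (meval_eq _ (fE x Vx ix hx)) k'E // k'0 mul0r.
move=> y Vy iy; rewrite mevalM mulf_eq0 negb_or => /andP[hy k'y].
have [jfy _] := hp y Vy iy hy.
have Wfy : pts W (f y) by exists j.
have ky : k.@[chart j (f y) 0] != 0.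
  by rewrite (meval_eq _ (fE y Vy iy hy)) k'E // mulf_neq0 ?invr_neq0 ?expf_neq0.
have [lgfy gE] := kq _ Wfy jfy ky; split=> // e.
rewrite /= gE !(meval_eq _ (fE y Vy iy hy)) k'E // q'E // mevalM.
rewrite -[RHS]mulf_div divff // mul1r invf_div mulrA divfK ?expf_neq0 //.
Qed.

End Composition.

Section GapPolynomials.
Variable K : closedFieldType.
Implicit Types (p q : {poly K}) (N k : nat).

Lemma poly_ext p q : (forall t, p.[t] = q.[t]) -> p = q.
Proof.
move=> pq; apply/eqP; rewrite -subr_eq0; apply/negPn/negP => /closed_nonrootP[t].
by rewrite rootE hornerD hornerN pq subrr eqxx.
Qed.

(* For odd N, the gap polynomials are those of K[t^2, t^N]. *)
Definition gap N p := forall k, odd k -> (k < N)%N -> p`_k = 0.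

Lemma gapD N p q : gap N p -> gap N q -> gap N (p + q).
Proof. by move=> gp gq k ok kN; rewrite coefD gp // gq // addr0. Qed.

Lemma gapZ N c p : gap N p -> gap N (c *: p).
Proof. by move=> gp k ok kN; rewrite coefZ gp // mulr0. Qed.

Lemma gapM N p q : gap N p -> gap N q -> gap N (p * q).
Proof.
move=> gp gq k ok kN; rewrite coefM big1 // => -[i /= ik] _.
have [oi|ei] := boolP (odd i); first by rewrite gp ?mul0r //; lia.
by rewrite gq ?mulr0 //; [rewrite oddB ?ok // (negPf ei) | lia].
Qed.

Lemma gap0 N : gap N 0.
Proof. by move=> k _ _; rewrite coef0. Qed.

Lemma gap1 N : gap N 1.
Proof. by move=> [|k] // _ _; rewrite coef1. Qed.

Lemma gapXn N k : ~~ odd k || (N <= k)%N -> gap N 'X^k.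
Proof.
move=> kN j oj jN; rewrite coefXn; case: eqP => // jk; move: kN.
by rewrite -jk oj /= leqNgt jN.
Qed.

Lemma gap_meval N n (p : {mpoly K[n]}) (h : 'I_n -> {poly K}) :
  (forall i, gap N (h i)) ->
  exists2 q, gap N q & forall t, p.@[fun i => (h i).[t]] = q.[t].
Proof.
move=> gh; exists (\sum_(m <- msupp p) p@_m *: \prod_i h i ^+ m i).
  apply: (big_ind (gap N)) => [|? ?|m _]; [exact: gap0|exact: gapD|].
  apply: gapZ; apply: (big_ind (gap N)) => [|? ?|i _]; [exact: gap1|exact: gapM|].
  by elim: (m i) => [|k IH]; [exact: gap1 | rewrite exprS; apply: gapM].
move=> t; rewrite mevalE horner_sum; apply: eq_bigr => m _.
rewrite hornerZ horner_prod; congr (_ * _); apply: eq_bigr => i _.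
by rewrite horner_exp.
Qed.

Lemma poly_cusp_param k p q : p != 0 -> q ^+ 2 = p ^+ k.*2.+1 ->
  exists2 r, p = r ^+ 2 & q = r ^+ k.*2.+1.
Proof.
move=> p0 qp; have : p ^+ k ^+ 2 %| q ^+ 2.
  by rewrite qp -exprM dvdp_exp2l // muln2.
rewrite dvdp_pexp2r // => /dvdpP[r qE].
have pE : r ^+ 2 = p.
  apply: (mulIf (x := p ^+ k ^+ 2)); first by rewrite !expf_neq0.
  by rewrite -exprMn -qE qp -exprM -exprS muln2.
exists r => //; rewrite qE -pE -exprM mul2n -exprS //.
Qed.

Lemma size2_gap i j p : [pchar K] =i pred0 -> size p = 2%N ->
  gap i.*2.+3 (p ^+ 2) -> gap i.*2.+3 (p ^+ j.*2.+3) ->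
  (i <= j)%N /\ exists2 a, a != 0 & p = a *: 'X.
Proof.
move=> ch0 sp g2 gj.
have a0 : p`_1 != 0.
  by have := lead_coef_eq0 p; rewrite lead_coefE sp -size_poly_eq0 sp => ->.
have pE : p = p`_1 *: 'X + (p`_0)%:P.
  apply/polyP => -[|[|k]]; rewrite coefD coefZ coefX coefC /= ?mulr0 ?mulr1 ?add0r ?addr0 //.
  by rewrite nth_default // sp.
have b0 : p`_0 = 0.
  have := g2 1%N erefl erefl.
  rewrite expr2 coefM !big_ord_recl big_ord0 /= addr0 mulrC -mulr2n -mulr_natr.
  have n2 : 2%:R != 0 :> K by have /pcharf0P -> := ch0.
  by move/eqP; rewrite !mulf_eq0 (negPf a0) (negPf n2) orbF => /eqP.
have pX : p = p`_1 *: 'X by rewrite {1}pE b0 addr0.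
split; last by exists p`_1.
rewrite leqNgt; apply/negP => ji.
have := gj j.*2.+3; rewrite {1}pX exprZn coefZ coefXn eqxx mulr1.
have -> : odd j.*2.+3 by rewrite /= odd_double.
have -> : (j.*2.+3 < i.*2.+3)%N by rewrite !ltnS ltn_double.
by move=> /(_ isT isT)/eqP; rewrite (negPf (expf_neq0 _ a0)).
Qed.

End GapPolynomials.

Section Cusps.
Variables (K : closedFieldType) (m : nat).
Implicit Types (i j : 'I_m) (k : 'I_(m + m)) (s t : K) (z : 'rV[K]_(m + m)).

Definition axis k : 'I_m := match split k with inl i | inr i => i end.

Definition expo k : nat := match split k with inl _ => 2%N | inr i => i.*2.+3 end.

Lemma axisl i : axis (lshift m i) = i. Proof. by rewrite /axis (unsplitK (inl i)). Qed.
Lemma axisr i : axis (rshift m i) = i. Proof. by rewrite /axis (unsplitK (inr i)). Qed.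
Lemma expol i : expo (lshift m i) = 2%N. Proof. by rewrite /expo (unsplitK (inl i)). Qed.
Lemma expor i : expo (rshift m i) = i.*2.+3.
Proof. by rewrite /expo (unsplitK (inr i)). Qed.

Lemma expo_gt0 k : (0 < expo k)%N.
Proof. by rewrite /expo; case: split. Qed.

(* The cusp y^2 = x^(2i+3) in the plane with coordinates lshift m i, rshift m i;
   distinct indices give non-isomorphic cusps. *)
Definition cusp i t : 'rV[K]_(m + m) := \row_k (t ^+ expo k *+ (axis k == i)).

Definition cusps_set : set 'rV[K]_(m + m) := [set z |
  (forall i, z 0 (rshift m i) ^+ 2 = z 0 (lshift m i) ^+ i.*2.+3) /\
  (forall ij : 'I_m * 'I_m, ij.1 != ij.2 ->
     z 0 (lshift m ij.1) * z 0 (lshift m ij.2) = 0)].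

Lemma cusps_closed : zclosed cusps_set.
Proof.
apply: zclosed_and; [apply: zclosed_forall => i|apply: zclosed_forall => ij].
  by apply: zclosed_eq; apply: polyfunX; apply: polyfun_coord.
apply: (@zclosed_polyfun _ _ (ij.1 != ij.2)
  (fun _ z => z 0 (lshift m ij.1) * z 0 (lshift m ij.2))) => // _.
by apply: polyfunM; apply: polyfun_coord.
Qed.

Definition cusps : affineVariety K := AffineVariety cusps_closed.

Lemma cusp_apts i t : apts cusps (cusp i t).
Proof.
split=> [j|[j l] /= jl]; rewrite !mxE ?axisl ?axisr ?expol ?expor.
  by case: eqP => _; rewrite ?mulr1n ?mulr0n ?expr0n // -!exprM mulnC.
have [<-|_] := eqVneq j i; last by rewrite mulr0n mul0r.
by rewrite eq_sym (negPf jl) mulr0n mulr0.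
Qed.

Definition cusp_pt i t : apoint cusps := exist _ _ (cusp_apts i t).

Lemma cusp_param i z : apts cusps z -> z 0 (lshift m i) != 0 ->
  z = cusp i (z 0 (rshift m i) / z 0 (lshift m i) ^+ i.+1).
Proof.
move=> [zz z0] zi.
set t := _ / _.
have t2 : t ^+ 2 = z 0 (lshift m i).
  rewrite /t expr_div_n zz -exprM muln2; apply: (mulIf (expf_neq0 i.*2.+2 zi)).
  by rewrite divfK ?expf_neq0 // -exprS.
apply/rowP => k; case: (split_ordP k) => j ->; rewrite mxE ?axisl ?axisr ?expol ?expor.
  have [->|ji] := eqVneq j i; first by rewrite t2.
  by have /eqP := z0 (j, i) ji; rewrite mulf_eq0 (negPf zi) orbF => /eqP.
have [->|ji] := eqVneq j i.
  rewrite mulr1n -doubleS exprS -mul2n exprM t2 /t divfK ?expf_neq0 //.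
have /eqP := z0 (j, i) ji; rewrite mulf_eq0 (negPf zi) orbF => /eqP zj.
by apply/eqP; have /eqP := zz j; rewrite zj expr0n /= expf_eq0.
Qed.

Lemma cusp_inj i j s t : t != 0 -> cusp i s = cusp j t -> i = j /\ s = t.
Proof.
move=> t0 /rowP E; have := E (lshift m j); have := E (rshift m j).
rewrite !mxE axisl axisr expol expor eqxx.
have [<-|_] := eqVneq j i; last first.
  by move=> _ /esym/eqP; rewrite mulr0n mulr1n (negPf (expf_neq0 _ t0)).
rewrite !mulr1n => E3 E2; split=> //.
apply: (mulIf (expf_neq0 j.+1 (expf_neq0 2 t0))).
by rewrite -{1}E2 -!exprM -!exprS mul2n doubleS.
Qed.

Lemma cusps_cover k z : apts cusps z -> exists i t, z = cusp i t.
Proof.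
move=> Xz; have [[i zi]|z0] := pselect (exists i, z 0 (lshift m i) != 0).
  by exists i; eexists; apply: cusp_param zi.
have {}z0 i : z 0 (lshift m i) = 0.
  by apply/eqP/negPn/negP => zi; apply: z0; exists i.
exists (axis k), 0; apply/rowP => l; rewrite mxE expr0n eqn0Ngt expo_gt0 mul0rn.
case: (split_ordP l) => j -> //.
by apply/eqP; have /eqP := Xz.1 j; rewrite z0 expr0n /= expf_eq0.
Qed.

Lemma endo_cusp (f : endo cusps) i : injective f -> exists j (r : {poly K}),
  [/\ gap i.*2.+3 (r ^+ 2), gap i.*2.+3 (r ^+ j.*2.+3) &
      forall t, f (cusp_pt i t) = cusp_pt j r.[t]].
Proof.
move=> f_inj.
have /choice[P PP] : forall k, exists P : {poly K}, gap i.*2.+3 P /\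
    forall t, sval (f (cusp_pt i t)) 0 k = P.[t].
  move=> k; have [p pE] := endo_regular f k.
  have [|P gP PE] := @gap_meval K i.*2.+3 _ p
    (fun k => 'X^(expo k) *+ (axis k == i)).
    move=> l; case: eqP => [il|_]; last exact: gap0.
    rewrite mulr1n; apply: gapXn; rewrite -il /expo /axis.
    by case: split => j //; rewrite leqnn orbT.
  exists P; split=> // t; rewrite pE -PE; apply: meval_eq => l.
  by rewrite mxE hornerMn hornerXn.
have Xf t := svalP (f (cusp_pt i t)).
have [[j Pj]|P0] := pselect (exists j, P (lshift m j) != 0); last first.
  have {}P0 j : P (lshift m j) = 0.
    by apply/eqP/negPn/negP => Pj; apply: P0; exists j.
  have f0 t : sval (f (cusp_pt i t)) = 0.
    apply/rowP => k; rewrite [RHS]mxE; case: (split_ordP k) => j ->.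
      by rewrite (PP _).2 P0 horner0.
    apply/eqP; have /eqP := (Xf t).1 j.
    by rewrite [in X in _ == X](PP _).2 P0 horner0 expr0n /= expf_eq0.
  have /f_inj/(congr1 sval)/esym/(cusp_inj (oner_neq0 K))[_] :
      f (cusp_pt i 1) = f (cusp_pt i 0).
    by apply: apoint_eq; rewrite !f0.
  by move/esym/eqP; rewrite oner_eq0.
have [|r r2 r3] := @poly_cusp_param K j.+1 _ (P (rshift m j)) Pj.
  by apply: poly_ext => t; rewrite !horner_exp -!(PP _).2; apply: (Xf t).1.
exists j, r; split; [by rewrite -r2; apply: (PP _).1|by rewrite -r3; apply: (PP _).1|].
move=> t; apply: apoint_eq; apply/rowP => k; rewrite (PP k).2 /= mxE.
have P0 l : l != j -> P (lshift m l) = 0.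
  move=> lj; have : P (lshift m l) * P (lshift m j) = 0.
    apply: poly_ext => u; rewrite hornerM horner0 -!(PP _).2.
    exact: (Xf u).2 (l, j) lj.
  by move=> /eqP; rewrite mulf_eq0 (negPf Pj) orbF => /eqP.
case: (split_ordP k) => l ->; rewrite ?axisl ?axisr ?expol ?expor.
  have [->|lj] := eqVneq l j; first by rewrite r2 horner_exp.
  by rewrite P0 // horner0.
have [->|lj] := eqVneq l j; first by rewrite r3 horner_exp.
suff /eqP : P (rshift m l) ^+ 2 = 0 by rewrite expf_eq0 => /eqP ->; rewrite horner0.
apply: poly_ext => u; rewrite horner0 horner_exp -(PP _).2 (Xf u).1.
by rewrite (PP _).2 P0 // horner0 expr0n.
Qed.

Lemma aut_cusp (f g : endo cusps) i : [pchar K] =i pred0 ->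
  cancel f g -> cancel g f ->
  exists2 a, a != 0 & forall t, f (cusp_pt i t) = cusp_pt i (a * t).
Proof.
move=> char0 fK gK.
have [j [r [r2 r3 fE]]] := endo_cusp i (can_inj fK).
have [i' [s [s2 s3 gE]]] := endo_cusp j (can_inj gK).
have gf t : cusp i' s.[r.[t]] = cusp i t.
  by have := congr1 sval (fK (cusp_pt i t)); rewrite fE gE.
have [ii' _] := cusp_inj (oner_neq0 K) (gf 1); rewrite {i'}ii' in s3 gE gf.
have sr : s \Po r = 'X.
  apply: poly_ext => t; rewrite horner_comp hornerX.
  have [->|t0] := eqVneq t 0; last by have [] := cusp_inj t0 (gf t).
  apply/eqP; have /rowP/(_ (lshift m i))/eqP := gf 0.
  by rewrite !mxE axisl eqxx expol expr0n /= mulr1n mul0rn expf_eq0.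
have [sr2 ss2] : size r = 2%N /\ size s = 2%N.
  have := size_comp_poly s r; rewrite sr size_polyX /=.
  by move/esym/eqP; rewrite muln_eq1; case: (size s) (size r) => [|[|[|?]]] [|[|[|?]]].
have [ij [a a0 rE]] := size2_gap char0 sr2 r2 r3.
have [ji _] := size2_gap char0 ss2 s2 s3.
have {ij ji} ij : i = j by apply/val_inj/eqP; rewrite eqn_leq ij ji.
by exists a => // t; rewrite fE -ij rE hornerZ hornerX.
Qed.

End Cusps.

Section TorusAction.
Variables (K : closedFieldType) (m : nat).
Notation X := (cusps K m).
Implicit Types (a b : torus_pt K m) (x : apoint X).

Definition scale_row a (z : 'rV[K]_(m + m)) : 'rV[K]_(m + m) :=
  \row_k (a 0 (axis k) ^+ expo k * z 0 k).

Lemma scale_cusp a i t : scale_row a (cusp i t) = cusp i (a 0 i * t).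
Proof.
apply/rowP => k; rewrite !mxE; case: eqP => [<-|_]; last by rewrite !mulr0n mulr0.
by rewrite !mulr1n exprMn.
Qed.

Lemma scale_apts a x : apts X (scale_row a (sval x)).
Proof.
case: x => z [z1 z2]; split=> [i|ij ij_neq] /=;
  rewrite !mxE ?axisl ?axisr ?expol ?expor.
  by rewrite exprMn z1 -exprM mulnC exprM -exprMn.
by rewrite mulrACA z2 // mulr0.
Qed.

Lemma scale_regular a k :
  regular_fun (fun x => scale_row a (sval x) 0 k).
Proof.
exists (a 0 (axis k) ^+ expo k *: 'X_k) => x.
by rewrite mxE mevalZ mevalXU.
Qed.

Definition scale_endo a : endo X :=
  @Endo K X (fun x => exist _ _ (scale_apts a x)) (scale_regular a).

Lemma scale_endoM a b x : scale_endo (a * b)%g x = scale_endo a (scale_endo b x).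
Proof.
by apply: apoint_eq; apply/rowP => k; rewrite /= !mxE exprMn mulrA.
Qed.

Lemma scale_endo1 x : scale_endo 1%g x = x.
Proof. by apply: apoint_eq; apply/rowP => k; rewrite /= !mxE expr1n mul1r. Qed.

Lemma scale_endoK a : cancel (scale_endo a) (scale_endo (a^-1)%g).
Proof. by move=> x; rewrite -scale_endoM mulVg scale_endo1. Qed.

Lemma scale_endoVK a : cancel (scale_endo (a^-1)%g) (scale_endo a).
Proof. by move=> x; rewrite -scale_endoM mulgV scale_endo1. Qed.

Definition scale_aut a : aut X := Aut (scale_endoK a) (scale_endoVK a).

Lemma scale_autM : {morph scale_aut : a b / (a * b)%g}.
Proof. by move=> a b; apply: aut_eq => x; apply: scale_endoM. Qed.

Lemma scale_aut_inj : injective scale_aut.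
Proof.
move=> a b ab; apply/val_inj/rowP => i.
have := congr1 (fun c : aut X => sval (c (cusp_pt i 1))) ab.
by rewrite /= !scale_cusp !mulr1 => /(cusp_inj (tval_neq0 b i))[].
Qed.

Lemma scale_aut_surj (f : aut X) : [pchar K] =i pred0 -> exists a, scale_aut a = f.
Proof.
move=> char0.
have /choice[v vP] : forall i, exists c, c != 0 /\
    forall t, f (cusp_pt i t) = cusp_pt i (c * t).
  by move=> i; have [c c0 cE] := aut_cusp i char0 (@aut_funK _ _ f) (@aut_invK _ _ f); exists c.
have v_neq0 : [forall i, (\row_i v i) 0 i != 0].
  by apply/forallP => i; rewrite mxE; case: (vP i).
exists (TorusPt v_neq0); apply: aut_eq => x; apply: apoint_eq; apply/rowP => k.
have [i [t xE]] := cusps_cover k (svalP x).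
have {xE} -> : x = cusp_pt i t by apply: apoint_eq.
by rewrite (vP i).2 /= scale_cusp !mxE.
Qed.

Lemma scale_aut_morphism : morphism (torus_atlas K m) (aut_filt X 1) scale_aut.
Proof.
have scale_deg a k : regular_le 1 (endo_coord (scale_endo a) k).
  exists (a 0 (axis k) ^+ expo k *: 'X_k) => [|x].
    by apply: leq_trans (msizeZ_le _ _) _; rewrite msizeX mdeg1.
  by rewrite /endo_coord mxE mevalZ mevalXU.
have scale_coef (w : 'I_m -> 'I_(m + m)) k mon : exists2 g : 'rV[K]_(m + m) -> K,
    polyfun g & forall a (z : 'rV_(m + m)), (forall i, a 0 i = z 0 (w i)) ->
    (normal_form (endo_coord (scale_endo a) k))@_mon = g z.
  pose c (z : 'rV[K]_(m + m)) := z 0 (w (axis k)) ^+ expo k *: 'X_k : {mpoly K[adim X]}.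
  exists (fun z => (normal_form (fun x : apoint X => (c z).@[sval x 0]))@_mon).
    apply: polyfam_normal_form; apply: polyfamZ; last exact: polyfam_const.
    by apply: polyfunX; apply: polyfun_coord.
  move=> a z az; congr (_@_mon); congr normal_form; apply/funext => x.
  by rewrite /endo_coord mxE /c mevalZ mevalXU az.
apply: regular_on_aut => [a _|[] k mon|[] k mon] /=.
- by split=> k; apply: scale_deg.
- have [g pg gE] := scale_coef (lshift m) k mon; exists g => // a _ _.
  by apply: gE => i; rewrite row_mxEl.
- have [g pg gE] := scale_coef (@rshift m m) k mon; exists g => // a _ _.
  by apply: gE => i; rewrite row_mxEr.
Qed.

Lemma scale_aut_inv_morphism (f : aut X -> torus_pt K m) d :
  cancel f scale_aut -> morphism (aut_filt X d) (torus_atlas K m) f.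
Proof.
move=> fK.
have valE (c : aut X) i t : sval (c (cusp_pt i t)) = cusp i (f c 0 i * t).
  by rewrite -{1}(fK c) /= scale_cusp.
have invE (c : aut X) i t :
    sval (aut_inv c (cusp_pt i t)) = cusp i ((f c 0 i)^-1 * t).
  by rewrite -{1}(fK c) /= scale_cusp mxE.
pose N := #|{: 'I_(m + m) * 'X_{1..(m + m) < d.+1}}|.
have evalP (phi : 'rV[K]_(N + N) -> 'rV[K]_N)
    i k : (forall l, polyfun (fun z => phi z 0 l)) ->
    polyfun (fun z => (Defs.coef_poly (X := X) (phi z) k).@[cusp i 1 0]).
  move=> pphi; apply: (@polyfun_coef_poly K X d _ phi k (fun j _ => cusp i 1 0 j)) => // j.
  exact: polyfun_const.
pose y i k (z : 'rV[K]_(N + N)) := (Defs.coef_poly (X := X) (d := d) (lsubmx z) k).@[cusp i 1 0].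
pose y' i k (z : 'rV[K]_(N + N)) := (Defs.coef_poly (X := X) (d := d) (rsubmx z) k).@[cusp i 1 0].
have py i k : polyfun (y i k) by apply: evalP; apply: polyfun_lsub.
have py' i k : polyfun (y' i k) by apply: evalP; apply: polyfun_rsub.
have yE c i k : dom (aut_filt X d) (tt, tt) c ->
    y i k (@chart _ _ (aut_filt X d) (tt, tt) c) = cusp i (f c 0 i) 0 k.
  move=> [rc _]; rewrite /y row_mxKl -[in RHS](mulr1 (f c 0 i)) -valE.
  by rewrite (endo_chart_eval _ (rc k)).
have y'E c i k : dom (aut_filt X d) (tt, tt) c ->
    y' i k (@chart _ _ (aut_filt X d) (tt, tt) c) = cusp i (f c 0 i)^-1 0 k.
  move=> [_ rc]; rewrite /y' row_mxKr -[in RHS](mulr1 (f c 0 i)^-1) -invE.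
  by rewrite (endo_chart_eval _ (rc k)).
(* [u = u^(2i+3) * (u^-2)^(i+1)] makes the torus coordinates polynomial in those
   of an automorphism and of its inverse. *)
have cuspE i (u : K) : u != 0 ->
    u = cusp i u 0 (rshift m i) * cusp i u^-1 0 (lshift m i) ^+ i.+1.
  move=> u0; rewrite !mxE axisl axisr expol expor eqxx !mulr1n -exprM mul2n doubleS.
  by rewrite exprVn exprSr mulrAC divff ?expf_neq0 ?mul1r.
apply: (@regular_on_poly _ _ _ _ _ (torus_atlas K m) _ tt) => [[]|//|[[] []] l] //.
case: (split_ordP l) => i ->.
  exists (fun z => y i (rshift m i) z * y' i (lshift m i) z ^+ i.+1).
    by apply: polyfunM => //; apply: polyfunX.
  move=> c _ dc; rewrite yE // y'E // row_mxEl; exact/cuspE/tval_neq0.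
exists (fun z => y' i (rshift m i) z * y i (lshift m i) z ^+ i.+1).
  by apply: polyfunM => //; apply: polyfunX.
move=> c _ dc; rewrite yE // y'E // row_mxEr mxE.
by have := cuspE i _ (invr_neq0 (tval_neq0 (f c) i)); rewrite invrK.
Qed.

End TorusAction.

Theorem mainTheorem6 (K : closedFieldType) (char0 : [pchar K] =i pred0)
    (T : algGroup K) (T_torus : is_torus T) :
  exists X : affineVariety K, ind_group_iso (Aut_ind_group X) (ind_of_alg T).
Proof.
have [m [u [v [uK vK uM u_mor v_mor]]]] := T_torus.
have /choice[f fK] := fun c : aut (cusps K m) => scale_aut_surj c char0.
have Kf : cancel (@scale_aut K m) f.
  by move=> a; apply: scale_aut_inj; rewrite fK.
exists (cusps K m), (v \o f), (@scale_aut K m \o u); split.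
- by move=> c /=; rewrite vK fK.
- by move=> a /=; rewrite Kf uK.
- move=> a b /=; apply: (can_inj uK); apply: scale_aut_inj.
  by rewrite vK uM !vK scale_autM !fK.
- move=> d; exists 0%N; apply: morphism_comp v_mor.
  exact: scale_aut_inv_morphism.
- move=> d; exists 1%N; apply: morphism_comp u_mor _.
  exact: scale_aut_morphism.
Qed.
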